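(* For every integer $r\geqslant1$, there is a unital extreme positive map $\Phi_r\colon\mathrm{Mat}_2(\mathbb C)\to\mathrm{Mat}_{2r+2}(\mathbb C)$; that is, there is a complex-linear positive map $\Phi_r$ with $\Phi_r(I_2)=I_{2r+2}$ which generates an extreme ray of the cone $\mathrm{Pos}(\mathrm{Mat}_2,\mathrm{Mat}_{2r+2})$.
   Context: A complex-linear map $\Phi\colon\mathrm{Mat}_2(\mathbb C)\to\mathrm{Mat}_s(\mathbb C)$ is positive if it maps positive semidefinite matrices to positive semidefinite matrices. $\mathrm{Pos}(\mathrm{Mat}_2,\mathrm{Mat}_s)$ denotes the convex cone of all such positive maps. A nonzero $\Phi$ in this cone generates an extreme ray if, whenever $\Phi=\Phi_1+\Phi_2$ with $\Phi_1,\Phi_2$ positive, both $\Phi_1$ and $\Phi_2$ are nonnegative real multiples of $\Phi$. *)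

(* Defs.v *)
From HB Require Import structures.
From mathcomp Require Import all_boot all_order all_algebra.
From mathcomp Require Import complex.
From mathcomp Require Import reals.

Set Implicit Arguments.
Unset Strict Implicit.
Unset Printing Implicit Defensive.

Import Order.TTheory GRing.Theory Num.Theory.

Local Open Scope ring_scope.
Local Open Scope sesquilinear_scope.
Local Open Scope complex_scope.

(* In the order of R[i], 0 <= z means that z is real and nonnegative. *)
Definition psdmx (R : realType) (n : nat) (A : 'M[R[i]]_n) : Prop :=
  A \is hermsymmx /\
  forall x : 'cV[R[i]]_n, 0 <= (x ^t* *m A *m x) ord0 ord0.

Definition positive_map (R : realType) (m n : nat)
    (Phi : {linear 'M[R[i]]_m -> 'M[R[i]]_n}) : Prop :=
  forall X : 'M[R[i]]_m, psdmx X -> psdmx (Phi X).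

Definition unital_map (R : realType) (m n : nat)
    (Phi : {linear 'M[R[i]]_m -> 'M[R[i]]_n}) : Prop :=
  Phi 1%:M = 1%:M.

Definition nonneg_multiple (R : realType) (m n : nat)
    (Psi Phi : {linear 'M[R[i]]_m -> 'M[R[i]]_n}) : Prop :=
  exists c : R, 0 <= c /\ forall X : 'M[R[i]]_m, Psi X = c%:C *: Phi X.

Definition generates_extreme_ray (R : realType) (m n : nat)
    (Phi : {linear 'M[R[i]]_m -> 'M[R[i]]_n}) : Prop :=
  [/\ positive_map Phi,
      (exists X : 'M[R[i]]_m, Phi X != 0)
    & forall Phi1 Phi2 : {linear 'M[R[i]]_m -> 'M[R[i]]_n},
        positive_map Phi1 -> positive_map Phi2 ->
        (forall X : 'M[R[i]]_m, Phi X = Phi1 X + Phi2 X) ->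
        nonneg_multiple Phi1 Phi /\ nonneg_multiple Phi2 Phi].

(* Main.v *)
(* For X = [[a, b], [b', d]] the map is, up to a diagonal congruence making it
   unital, a tridiagonal matrix M(X) whose diagonal entries are nonnegative
   combinations of a and d and whose off-diagonal entries are multiples of b
   and b'. Its coefficients are chosen so that M(v v^* ) has a kernel vector
   w_v of bidegree (2r, 1) in v for every v in C^2: with v = (1, z) and
   t = |z|^2 the vector is (conj z, p_1, z p_2, ..., z^(2r-1) p_2r, z^(2r)),
   where p_i is 2 + t for odd i and 1 + 2 t for even i. After removing phases
   this is a positive vector annihilated by a Jacobi matrix with nonpositive
   off-diagonal entries, so M(v v^* ) is positive semidefinite. If M is a sum
   of two positive maps, each also annihilates w_v at v v^* for every v;
   comparing coefficients, such a map is N M for a constant matrix N, and hermiticity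
   together with the tridiagonal shape forces N to be a nonnegative scalar. *)

Require Import Defs.
From HB Require Import structures.
From mathcomp Require Import all_boot all_order all_algebra.
From mathcomp Require Import complex.
From mathcomp Require Import reals.
From mathcomp Require Import zify ring.

Set Implicit Arguments.
Unset Strict Implicit.
Unset Printing Implicit Defensive.

Import Order.TTheory GRing.Theory Num.Theory.

Local Open Scope ring_scope.

(** * Coefficients of the tridiagonal matrix *)

Definition adiag (r i : nat) : nat :=
  if i == 0 then 6 else if i == 1 then 0 else if i == r.*2 then 2
  else if i == r.*2.+1 then 3 else if odd i then 1 else 2.

Definition ddiag (r i : nat) : nat :=
  if i == 0 then 3 else if i == 1 then 2 else if i == r.*2 then 0
  else if i == r.*2.+1 then 6 else if odd i then 2 else 1.

Definition link (r i : nat) : nat :=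
  if (i == 0) || (i == r.*2) then 3 else if odd i then 1 else 2.

(** [b] and [b'] are independent arguments, which keeps the matrix complex-linear in X; in the
    Hermitian case [b'] is the conjugate of [b]. *)
Definition entry (K : pzRingType) (r : nat) (a d b b' : K) (i j : nat) : K :=
  if i == j then a *+ adiag r i + d *+ ddiag r i
  else if j == i.+1 then - (b *+ link r i)
  else if i == j.+1 then - (b' *+ link r j) else 0.

Lemma adiag_mid r i : (1 < i < r.*2)%N -> adiag r i = if odd i then 1 else 2.
Proof. by case/andP=> i1 ir; rewrite /adiag; do 4?case: eqP => //; lia. Qed.

Lemma ddiag_mid r i : (1 < i < r.*2)%N -> ddiag r i = if odd i then 2 else 1.
Proof. by case/andP=> i1 ir; rewrite /ddiag; do 4?case: eqP => //; lia. Qed.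

Lemma link_mid r i : (0 < i < r.*2)%N -> link r i = if odd i then 1 else 2.
Proof. by case/andP=> i1 ir; rewrite /link; do 2?case: eqP => //; lia. Qed.

(** * Positivity of the quadratic form *)

Section Positivity.

Variables (C : numClosedFieldType) (r : nat) (a d b : C) (w : nat -> C).
Hypothesis r_gt0 : (0 < r)%N.
Hypothesis psd2 : forall u v : C,
  0 <= u^* * a * u + u^* * b * v + v^* * b^* * u + v^* * d * v.

Let ent := entry r a d b b^*.
Let Q n := \sum_(i < n) \sum_(j < n) (w i)^* * ent i j * w j.

(** [Q n] is the form of the leading block of size n; by tridiagonality, enlarging the block by one
    adds one diagonal term and one link. *)
Lemma quad_form_rec n :
  Q n.+2 = Q n.+1 + (a *+ adiag r n.+1 + d *+ ddiag r n.+1) * ((w n.+1)^* * w n.+1)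
    - ((w n)^* * b * w n.+1 + (w n.+1)^* * b^* * w n) *+ link r n.
Proof.
have ent0 i j : (i.+1 < j)%N || (j.+1 < i)%N -> ent i j = 0.
  by move=> ij; rewrite /ent /entry; do 3?case: eqP => //; lia.
have entS i : ent i i.+1 = - (b *+ link r i).
  by rewrite /ent /entry eqxx ltn_eqF.
have entP i : ent i.+1 i = - (b^* *+ link r i).
  by rewrite /ent /entry eqxx gtn_eqF // ltn_eqF.
have entD i : ent i i = a *+ adiag r i + d *+ ddiag r i.
  by rewrite /ent /entry eqxx.
rewrite /Q big_ord_recr /=.
under eq_bigr do rewrite big_ord_recr /=.
rewrite big_split /= -addrA -addrA; congr (_ + _).
have -> : \sum_(i < n.+1) (w i)^* * ent i n.+1 * w n.+1 =
    - ((w n)^* * b * w n.+1 *+ link r n).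
  rewrite big_ord_recr /= big1 ?add0r => [|i _].
    by rewrite entS mulrN mulNr mulrnAr mulrnAl.
  by rewrite ent0 ?mulr0 ?mul0r // ltnS ltn_ord.
rewrite !big_ord_recr /= big1 => [|i _]; last first.
  by rewrite ent0 ?mulr0 ?mul0r // !ltnS ltn_ord orbT.
rewrite entP entD.
move: (a *+ _ + _) (w n) (w n.+1) (w n)^* (w n.+1)^* b^*.
by move: (link r n) => l x y z y' z' b'; ring.
Qed.

Lemma a_ge0 : 0 <= a.
Proof. by have := psd2 1 0; rewrite conjC1 conjC0; congr (0 <= _); ring. Qed.

Lemma d_ge0 : 0 <= d.
Proof. by have := psd2 0 1; rewrite conjC1 conjC0; congr (0 <= _); ring. Qed.

Hypothesis ad_gt0 : 0 < a + d.

Lemma det_ge0 : 0 <= a * d - b * b^*.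
Proof.
have aR : a^* = a by apply/CrealP/ger0_real/a_ge0.
have dR : d^* = d by apply/CrealP/ger0_real/d_ge0.
rewrite -(pmulr_rge0 _ ad_gt0).
(* Up to sign, the test vectors are the columns of the adjugate; the form takes there the values a
   and d times the determinant. *)
have := addr_ge0 (psd2 b (- a)) (psd2 (- d) b^*).
rewrite !rmorphN /= aR dR conjCK.
by congr (0 <= _); ring.
Qed.

(** The interior factors [2 + t] and [1 + 2 t] of the kernel vector, homogenized in [a] and [d]. *)
Let rho n := if odd n then a *+ 2 + d else a + d *+ 2.

Lemma rho_gt0 n : 0 < rho n.
Proof.
rewrite /rho; case: odd.
  by rewrite mulr2n -addrA ltr_wpDl ?a_ge0.
by rewrite mulr2n addrA ltr_wpDr ?d_ge0.
Qed.

(** The adjugate of a positive semidefinite 2 by 2 matrix is again positive semidefinite. *)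
Lemma link_form_ge0 (u v : C) :
  0 <= d * (u^* * u) + a * (v^* * v) - (u^* * b * v + v^* * b^* * u).
Proof.
have := psd2 v^* (- u^*); rewrite rmorphN /= !conjCK.
by congr (0 <= _); ring.
Qed.

(* Squares are completed from the first coordinate on, with weights read off
   the kernel vector: each link absorbs a multiple of [link_form_ge0], and the
   subtracted term is the part of the diagonal left for the next link. *)
Lemma partial_quad_form_ge0 n : (0 < n < r.*2)%N ->
  0 <= Q n.+1 - d * (rho n.+1 / rho n) * ((w n)^* * w n) *+ link r n.
Proof.
have aR : a^* = a by apply/CrealP/ger0_real/a_ge0.
have dR : d^* = d by apply/CrealP/ger0_real/d_ge0.
elim: n => // -[_ _|n IHn nr].
  rewrite quad_form_rec /Q !big_ord1 /ent /entry /adiag /ddiag /link /=.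
  rewrite [_ == r.*2]ltn_eqF ?ifN; try lia.
  have /= := rho_gt0 1; have /= := rho_gt0 2; rewrite /rho /= => r2 r1.
  (* Completing the square in [w 0], whose pivot is three times [rho 1], leaves a multiple of the
     determinant as the coefficient of [w 1]. *)
  have -> : (w 0)^* * (a *+ 6 + d *+ 3) * w 0
       + (a *+ 0 + d *+ 2) * ((w 1)^* * w 1)
       - ((w 0)^* * b * w 1 + (w 1)^* * b^* * w 0) *+ 3
       - d * ((a + d *+ 2) / (a *+ 2 + d)) * ((w 1)^* * w 1) *+ 1
     = 3%:R / (a *+ 2 + d) *
       (((a *+ 2 + d) * w 0 - b * w 1) * ((a *+ 2 + d) * w 0 - b * w 1)^*
        + (a * d - b * b^*) * (w 1 * (w 1)^*)).
    rewrite rmorphB !rmorphM rmorphD rmorphMn /= aR dR.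
    by field; rewrite mulr_natr lt0r_neq0.
  apply: mulr_ge0; first by rewrite divr_ge0 // ltW.
  by rewrite addr_ge0 ?mul_conjC_ge0 // mulr_ge0 ?mul_conjC_ge0 ?det_ge0.
have {}IHn := IHn ltac:(lia).
rewrite quad_form_rec.
have -> : a *+ adiag r n.+2 + d *+ ddiag r n.+2 = rho n.+1.
  rewrite adiag_mid ?ddiag_mid; try lia.
  by rewrite /rho /= negbK; case: odd; rewrite /= mulr1n.
have -> : rho n.+3 = rho n.+1 by rewrite /rho /= negbK.
(* This splits the diagonal entry: the [a] share pays for the link behind, the [d] share is kept for
   the link ahead. *)
have rhoE : rho n.+2 = a *+ link r n.+1 + d *+ link r n.+2.
  rewrite !link_mid; try lia.
  by rewrite /rho /= negbK; case: odd; rewrite /= mulr1n.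
have r1 := rho_gt0 n.+1; have r2 := rho_gt0 n.+2.
have r1R : (rho n.+1)^* = rho n.+1 by apply/CrealP/ger0_real/ltW.
have r2R : (rho n.+2)^* = rho n.+2 by apply/CrealP/ger0_real/ltW.
have link_ge0 := link_form_ge0 (rho n.+2 * w n.+1) (rho n.+1 * w n.+2).
have {link_ge0} := mulr_ge0 (divr_ge0 (ler0n C (link r n.+1))
  (ltW (mulr_gt0 r1 r2))) link_ge0.
move/(addr_ge0 IHn); congr (0 <= _).
rewrite !rmorphM /= r1R r2R.
move: (rho n.+1) (rho n.+2) (Q n.+2) rhoE r1 r2 => x y q yE /lt0r_neq0 x0 /lt0r_neq0 y0.
move: (link r n.+1) (link r n.+2) yE => g g' yE.
have dE : d *+ g' = y - a *+ g by rewrite yE addrAC subrr add0r.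
rewrite -[d * (x / y) * _ *+ g']mulrnAl -[d * (x / y) *+ g']mulrnAl dE.
move: (w n.+1) (w n.+2) (w n.+1)^* (w n.+2)^* b^* => u v u' v' b' {dE yE}.
by field; rewrite y0 x0.
Qed.

(** The other end mirrors the first one: one more link form, then a completed square in the last
    coordinate. The two shares of the coordinate 2r, a(2a+d)/(a+2d) and 3ad/(a+2d), add up to its
    diagonal entry 2a. *)
Lemma entry_quad_form_ge0 : 0 <= Q r.*2.+2.
Proof.
have aR : a^* = a by apply/CrealP/ger0_real/a_ge0.
have dR : d^* = d by apply/CrealP/ger0_real/d_ge0.
have [m rE] : exists m, r.*2 = m.+1 by exists r.*2.-1; lia.
have oddm : odd m by rewrite -[odd m]negbK -oddS -rE odd_double.
have := partial_quad_form_ge0 (n := m) ltac:(lia).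
have r1 : 0 < a *+ 2 + d by have := rho_gt0 1.
have r2 : 0 < a + d *+ 2 by have := rho_gt0 0.
rewrite !quad_form_rec rE quad_form_rec /rho /= oddm /=.
have -> : link r m = 1%N by rewrite /link oddm rE !ifN //; lia.
have -> : link r m.+1 = 3%N by rewrite /link rE eqxx orbT.
have -> : adiag r m.+1 = 2%N by rewrite /adiag rE eqxx !ifN //; lia.
have -> : ddiag r m.+1 = 0%N by rewrite /ddiag rE eqxx !ifN //; lia.
have -> : adiag r m.+2 = 3%N by rewrite /adiag rE eqxx !ifN //; lia.
have -> : ddiag r m.+2 = 6%N by rewrite /ddiag rE eqxx !ifN //; lia.
move=> Q_ge0.
have r1R : (a *+ 2 + d)^* = a *+ 2 + d by apply/CrealP/ger0_real/ltW.
have r2R : (a + d *+ 2)^* = a + d *+ 2 by apply/CrealP/ger0_real/ltW.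
have link_ge0 := link_form_ge0 ((a + d *+ 2) * w m) ((a *+ 2 + d) * w m.+1).
have {link_ge0} := mulr_ge0 (ltW (divr_gt0 ltr01 (mulr_gt0 r1 r2))) link_ge0.
move/(addr_ge0 Q_ge0) => {}Q_ge0.
pose e := (a + d *+ 2) * w m.+2 - b^* * w m.+1.
have last_ge0 : 0 <= 3%:R / (a + d *+ 2) *
    (e * e^* + (a * d - b * b^*) * (w m.+1 * (w m.+1)^*)).
  apply: mulr_ge0; first by rewrite divr_ge0 // ltW.
  by rewrite addr_ge0 ?mul_conjC_ge0 // mulr_ge0 ?mul_conjC_ge0 ?det_ge0.
have := addr_ge0 Q_ge0 last_ge0; congr (0 <= _).
rewrite /e rmorphB !rmorphM /= r1R r2R conjCK.
by field; rewrite !mulr_natr !lt0r_neq0.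
Qed.

End Positivity.

(** * Vanishing of polynomials on circles and in the squared radius *)

Section KernelEquations.

Variable C : numClosedFieldType.

Lemma poly_circle_eq0 (p : {poly C}) (rho : C) : 0 < rho ->
  (forall z, z * z^* = rho ^+ 2 -> p.[z] = 0) -> p = 0.
Proof.
move=> rho_gt0 p0; have rhoR : rho^* = rho by apply/CrealP/ger0_real/ltW.
(* The Cayley transform of the naturals yields infinitely many distinct points of the circle, more
   than a nonzero polynomial has roots. *)
pose u (n : nat) : C := rho * ((n%:R + 'i) / (n%:R - 'i)).
have sum_neq0 n : n%:R + 'i != 0 :> C.
  apply/eqP => /(congr1 Num.norm); rewrite normr0 => /eqP.
  rewrite normr_eq0 addr_eq0 => /eqP ni.
  have /negP[] := neq0Ci C.
  have : ('i : C) ^+ 2 = n%:R ^+ 2 by rewrite -sqrrN -ni.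
  rewrite sqrCi => /eqP; rewrite -subr_eq0 -opprD oppr_eq0.
  by rewrite paddr_eq0 ?ler01 ?exprn_ge0 // oner_eq0.
have dif_neq0 n : n%:R - 'i != 0 :> C.
  by rewrite -conjCi -[n%:R]conjC_nat -rmorphD conjC_eq0.
have u_norm n : u n * (u n)^* = rho ^+ 2.
  rewrite /u rmorphM fmorph_div rmorphD rmorphB /= conjC_nat conjCi rhoR opprK.
  by field; rewrite sum_neq0 dif_neq0.
have u_inj : injective u.
  move=> m n /(mulfI (lt0r_neq0 rho_gt0)) /eqP.
  rewrite eqr_div // => /eqP mn; apply/eqP.
  rewrite -(eqr_nat C) -subr_eq0.
  have /eqP : 2%:R * 'i * (m%:R - n%:R) = 0 :> C.
    transitivity ((m%:R + 'i) * (n%:R - 'i) * -1 + (n%:R + 'i) * (m%:R - 'i) : C).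
      ring.
    rewrite mn; ring.
  by rewrite !mulf_eq0 pnatr_eq0 (negbTE (neq0Ci C)).
apply/eqP; apply/negPn/negP => p_neq0.
have := max_poly_roots (rs := [seq u n | n <- iota 0 (size p)]) p_neq0.
rewrite map_inj_uniq // iota_uniq size_map size_iota ltnn => /(_ _ isT) H.
suff /H : all (root p) [seq u n | n <- iota 0 (size p)] by [].
by apply/allP => _ /mapP[n _ ->]; apply/rootP/p0.
Qed.

Lemma quadratic_coef_eq0 (c0 c1 c2 : C) :
  (forall rho : C, 0 < rho ->
    c0 + c1 * rho ^+ 2 + c2 * (rho ^+ 2) ^+ 2 = 0) ->
  [/\ c0 = 0, c1 = 0 & c2 = 0].
Proof.
move=> H.
have {}H n : c0 + c1 * n.+1%:R ^+ 2 + c2 * (n.+1%:R ^+ 2) ^+ 2 = 0.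
  by apply: H; rewrite ltr0Sn.
have [[f1 f4] f9] := (H 0, H 1, H 2).
have c2_0 : c2 = 0.
  apply: (mulfI (x := 120%:R)); first by rewrite pnatr_eq0.
  (* The weights 3, -8, 5 at the squared radii 9, 4, 1 cancel [c0] and [c1] and leave 120 [c2]. *)
  transitivity (3%:R * (c0 + c1 * 3%:R ^+ 2 + c2 * (3%:R ^+ 2) ^+ 2)
    - 8%:R * (c0 + c1 * 2%:R ^+ 2 + c2 * (2%:R ^+ 2) ^+ 2)
    + 5%:R * (c0 + c1 * 1%:R ^+ 2 + c2 * (1%:R ^+ 2) ^+ 2)); first by ring.
  by rewrite f1 f4 f9; ring.
move: f1 f4; rewrite c2_0 !mul0r !addr0 => f1 f4.
have c1_0 : c1 = 0.
  apply: (mulfI (x := 3%:R)); first by rewrite pnatr_eq0.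
  transitivity ((c0 + c1 * 2%:R ^+ 2) - (c0 + c1 * 1%:R ^+ 2)); first by ring.
  by rewrite f1 f4; ring.
by split => //; rewrite -f1 c1_0 mul0r addr0.
Qed.

End KernelEquations.

(** * The kernel vector *)

Section Kernel.

Variables (C : numClosedFieldType) (r : nat).
Hypothesis r_gt0 : (0 < r)%N.

(* The value at 0 makes [mul_kernel_vec] uniform in the index. *)
Definition profile (t : C) (i : nat) : C :=
  if i == 0 then t else if i == r.*2.+1 then 1
  else if odd i then 2%:R + t else 1 + 2%:R * t.

Lemma profile_odd t i : odd i -> (i < r.*2)%N -> profile t i = 2%:R + t.
Proof. by rewrite /profile => oi ir; rewrite oi; do 2?case: eqP => //; lia. Qed.

Lemma profile_even t i : ~~ odd i -> (0 < i)%N -> profile t i = 1 + 2%:R * t.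
Proof.
by rewrite /profile => oi i0; rewrite (negbTE oi); do 2?case: eqP => //; lia.
Qed.

Lemma profile_last t : profile t r.*2.+1 = 1.
Proof. by rewrite /profile eqxx. Qed.

Definition kernel_vec (z : C) (i : nat) : C :=
  if i is k.+1 then z ^+ k * profile (z * z^*) i else z^*.

Lemma kernel_vecS z k : kernel_vec z k.+1 = z ^+ k * profile (z * z^*) k.+1.
Proof. by []. Qed.

Lemma mul_kernel_vec z i : z * kernel_vec z i = z ^+ i * profile (z * z^*) i.
Proof. by case: i => [|k]; rewrite /kernel_vec ?expr0 ?mul1r // mulrA -exprS. Qed.

Lemma entry_sum (a d b b' : C) (w : nat -> C) i : (i < r.*2.+2)%N ->
  \sum_(j < r.*2.+2) entry r a d b b' i j * w j =
  (a *+ adiag r i + d *+ ddiag r i) * w i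
  - (if (i.+1 < r.*2.+2)%N then b *+ link r i * w i.+1 else 0)
  - (if i is k.+1 then b' *+ link r k * w k else 0).
Proof.
move=> ir.
pose T (c : nat) (x : C) (j : nat) := if j == c then x * w j else 0.
have sumT c x : \sum_(j < r.*2.+2) T c x j = if (c < r.*2.+2)%N then x * w c else 0.
  by rewrite -big_mkcond /= (big_ord1_eq _ (fun j => x * w j)).
have entryT j : entry r a d b b' i j * w j =
    T i (a *+ adiag r i + d *+ ddiag r i) j - T i.+1 (b *+ link r i) j
    - (if i is k.+1 then T k (b' *+ link r k) j else 0).
  rewrite /entry /T eq_sym; case: eqP => [->|ji].
    rewrite ltn_eqF // subr0; case: i {ir sumT} => [|k]; rewrite ?subr0 //.
    by rewrite gtn_eqF ?subr0.
  case: (j =P i.+1) => [->|ji1].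
    rewrite sub0r mulNr; case: i {ir ji sumT} => [|k]; rewrite ?subr0 //.
    by rewrite gtn_eqF ?subr0.
  case: i {ir sumT} ji ji1 => [|k] ji ji1; rewrite ?subr0 ?mul0r //.
  by rewrite eqSS eq_sym; case: eqP => [->|_]; rewrite sub0r ?mulNr ?oppr0 ?mul0r.
under eq_bigr do rewrite entryT.
rewrite !sumrB !sumT ir; congr (_ - _).
case: i ir {entryT} => [|k] ir; first by rewrite big1.
by rewrite sumT (ltnW ir).
Qed.

(** The arguments of [entry] are the entries of v v^* for v = (1, z). In each row a power of z, or
    its conjugate, factors out and leaves an identity in |z|^2; the cases are two rows at each end
    and the two parities in between. *)
Lemma entry_kernel_vec z i : (i < r.*2.+2)%N ->
  \sum_(j < r.*2.+2) entry r 1 (z * z^*) z^* z i j * kernel_vec z j = 0.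
Proof.
move=> ir; rewrite entry_sum //; have [i0|i_gt0] := posnP i.
  subst i; rewrite /= (@profile_odd _ 1) //; last lia.
  by rewrite /adiag /ddiag /link /=; ring.
have [k iE] : exists k, i = k.+1 by exists i.-1; lia.
subst i; have [k0|k_gt0] := posnP k.
  subst k; rewrite /= !ltnS double_gt0 r_gt0 (@profile_odd _ 1) //; last lia.
  rewrite (@profile_even _ 2) // (_ : link r 1 = 1%N); last first.
    by rewrite /link /= ifN //; lia.
  by rewrite /adiag /ddiag /link /=; ring.
have [j kE] : exists j, k = j.+1 by exists k.-1; lia.
have [kr|k_neq] := eqVneq k r.*2.
  have -> : adiag r k.+1 = 3%N by rewrite /adiag kr eqxx !ifN //; lia.
  have -> : ddiag r k.+1 = 6%N by rewrite /ddiag kr eqxx !ifN //; lia.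
  have -> : link r k = 3%N by rewrite /link kr eqxx orbT.
  have -> : (k.+2 < r.*2.+2)%N = false by lia.
  have pk : profile (z * z^*) k.+1 = 1 by rewrite kr profile_last.
  rewrite kE !kernel_vecS -kE pk (@profile_even _ k) ?kr ?odd_double ?double_gt0 //.
  rewrite -kr kE exprS.
  by ring.
have k_lt : (k < r.*2)%N by lia.
have [kr|k1_neq] := eqVneq k.+1 r.*2.
  have ok : odd k by rewrite -[odd k]negbK -oddS kr odd_double.
  have -> : adiag r k.+1 = 2%N by rewrite /adiag kr eqxx !ifN //; lia.
  have -> : ddiag r k.+1 = 0%N by rewrite /ddiag kr eqxx !ifN //; lia.
  have -> : link r k = 1%N by rewrite link_mid ?ok // k_gt0.
  have -> : link r k.+1 = 3%N by rewrite /link kr eqxx orbT.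
  have -> : (k.+2 < r.*2.+2)%N by lia.
  have pk : profile (z * z^*) k.+2 = 1 by rewrite kr profile_last.
  rewrite kE !kernel_vecS -kE pk (@profile_even _ k.+1) /= ?ok // (@profile_odd _ k) //.
  by rewrite kE !exprS; ring.
have -> : (k.+2 < r.*2.+2)%N by lia.
rewrite adiag_mid ?ddiag_mid ?[link r k.+1]link_mid ?[link r k]link_mid; try lia.
rewrite kE !kernel_vecS -kE.
case ok: (odd k); rewrite /= ?ok /=.
  rewrite (@profile_odd _ k) // (@profile_even _ k.+1) /= ?ok //.
  rewrite (@profile_odd _ k.+2) /= ?ok //; last lia.
  by rewrite kE !exprS; ring.
rewrite (@profile_odd _ k.+1) /= ?ok //; last lia.
rewrite !profile_even /= ?ok //.
by rewrite kE !exprS; ring.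
Qed.

(** * Rows that annihilate the kernel vector *)

Section Row.

Variables A D E G : nat -> C.
Hypothesis row0 : forall z,
  \sum_(k < r.*2.+2) (A k + z * z^* * D k + z^* * E k + z * G k) * kernel_vec z k
    = 0.

(** On the circle |z|^2 = t the conjugate of z is t/z, so z^2 times the row equation is a polynomial
    in z, and all its coefficients vanish. *)
Lemma row_coefs (rho t : C) : 0 < rho -> t = rho ^+ 2 ->
  [/\ E 0 = 0, G r.*2.+1 = 0 &
    forall m, (m < r.*2.+2)%N ->
      (A m + t * D m) * profile t m
      + (if m is k.+1 then G k * profile t k else 0)
      + (if (m.+1 < r.*2.+2)%N then t * E m.+1 * profile t m.+1 else 0) = 0].
Proof.
move=> rho_gt0 tE; have t_neq0 : t != 0 by rewrite tE expf_neq0 ?lt0r_neq0.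
pose p : {poly C} :=
  (\poly_(k < r.*2.+2) ((A k + t * D k) * profile t k)) * 'X
  + \poly_(k < r.*2.+2) (t * E k * profile t k)
  + (\poly_(k < r.*2.+2) (G k * profile t k)) * 'X^2.
have p0 : p = 0.
  apply: (poly_circle_eq0 rho_gt0) => z; rewrite -tE => zt.
  rewrite !hornerD !hornerM !hornerX !horner_poly.
  transitivity (z ^+ 2 * \sum_(k < r.*2.+2)
    (A k + z * z^* * D k + z^* * E k + z * G k) * kernel_vec z k).
    rewrite !mulr_suml mulr_sumr -!big_split /=.
    apply: eq_bigr => k _.
    transitivity (z * (A k + z * z^* * D k + z^* * E k + z * G k)
      * (z * kernel_vec z k)); last by ring.
    by rewrite mul_kernel_vec -zt; ring.
  by rewrite row0 mulr0.
have p_m m : p`_m = 0 by rewrite p0 coef0.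
split.
- have := p_m 0; rewrite !coefD coefMX coefMXn !coef_poly /= ?add0r ?addr0.
  by move/eqP; rewrite /profile /= !mulf_eq0 (negbTE t_neq0) orbF => /eqP.
- have := p_m r.*2.+3.
  rewrite !coefD coefMX coefMXn !coef_poly /= !subSS subn0 ltnn ltnNge leqnSn /=.
  by rewrite !add0r leqnn /profile eqxx mulr1.
- move=> m ms; have := p_m m.+1.
  rewrite !coefD coefMX coefMXn !coef_poly /= ms.
  case: m ms => [|k] ks; rewrite ?addr0 ?subSS ?subn0 //=.
  rewrite (ltnW ks).
  by rewrite addrAC.
Qed.

(** The entry of N in column m. The sum is used because [adiag] vanishes at 1 and [ddiag] at 2r, but
    never both at once. *)
Let scale m := (A m + D m) / (adiag r m + ddiag r m)%:R.

(** The unknowns A at m, D at m, G at m-1 and E at m+1, as far as they exist, occur together in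
    equation m of [row_coefs] and in no other equation of that family. Comparing powers of t leaves
    a one-dimensional solution space, spanned by row m of the tridiagonal matrix. *)
Lemma row_scale m : (m < r.*2.+2)%N ->
  [/\ A m = scale m *+ adiag r m, D m = scale m *+ ddiag r m,
    forall k, m = k.+1 -> G k = - (scale m *+ link r k) &
    (m.+1 < r.*2.+2)%N -> E m.+1 = - (scale m *+ link r m)].
Proof.
move=> ms.
have eq_by n (x y z : C) : z = 0 -> (x - y) *+ n.+1 = z -> x = y.
  by move=> -> /eqP; rewrite mulrn_eq0 /= subr_eq0 => /eqP.
have eqm rho : 0 < rho -> _ := fun rho0 =>
  let: And3 _ _ h := row_coefs rho0 erefl in h m ms.
have [m0|m_gt0] := posnP m.
  subst m; rewrite /scale /adiag /ddiag /link /=.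
  have [rho rho0|h1 h2 _] := @quadratic_coef_eq0 C (A 0 + 2%:R * E 1) (D 0 + E 1) 0.
    (* At m = 0 the whole equation carries a factor t, since [profile] equals t there. *)
    apply: (mulfI (x := rho ^+ 2)); first by rewrite expf_neq0 ?lt0r_neq0.
    have := eqm rho rho0.
    rewrite /= (@profile_odd _ 1) //; last lia.
    by move=> h; rewrite ?mulr0 -[RHS]h /profile /=; ring.
  have D0 : D 0 = - E 1 by apply: (eq_by 0 _ _ _ h2); ring.
  have A0 : A 0 = - 2%:R * E 1 by apply: (eq_by 0 _ _ _ h1); ring.
  by rewrite D0 A0; split=> // *; field.
have [k mE] : exists k, m = k.+1 by exists m.-1; lia.
subst m.
have [k0|k_gt0] := posnP k.
  subst k; rewrite /scale /adiag /ddiag /=.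
  have -> : link r 1 = 1%N by rewrite /link /= ifN //; lia.
  have [rho rho0|h0 h1 h2] := @quadratic_coef_eq0 C (2%:R * A 1)
      (A 1 + 2%:R * D 1 + G 0 + E 2) (D 1 + 2%:R * E 2).
    have := eqm rho rho0; rewrite /= !ltnS double_gt0 r_gt0.
    rewrite (@profile_odd _ 1) // ?(@profile_even _ 2) //; last lia.
    by move=> h; rewrite ?mulr0 -[RHS]h /profile /=; ring.
  have A1 : A 1 = 0 by apply: (eq_by 1 _ _ _ h0); ring.
  have D1 : D 1 = - 2%:R * E 2 by apply: (eq_by 0 _ _ _ h2); ring.
  have G0 : G 0 = 3%:R * E 2.
    by move: h1; rewrite A1 D1 => h1; apply: (eq_by 0 _ _ _ h1); ring.
  have l0 : link r 0 = 3%N by [].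
  by rewrite A1 D1; split=> // [|j [<-]|_]; rewrite ?G0 ?l0; field.
have [kE|k_neq] := eqVneq k r.*2.
  subst k; rewrite /scale.
  have -> : adiag r r.*2.+1 = 3%N by rewrite /adiag eqxx !ifN //; lia.
  have -> : ddiag r r.*2.+1 = 6%N by rewrite /ddiag eqxx !ifN //; lia.
  have l0 : link r r.*2 = 3%N by rewrite /link eqxx orbT.
  have [rho rho0|h0 h1 _] := @quadratic_coef_eq0 C
      (A r.*2.+1 + G r.*2) (D r.*2.+1 + 2%:R * G r.*2) 0.
    have := eqm rho rho0; rewrite /= ltnn profile_last profile_even ?odd_double //.
    by move=> h; rewrite -[RHS]h; ring.
  have A1 : A r.*2.+1 = - G r.*2 by apply: (eq_by 0 _ _ _ h0); ring.
  have D1 : D r.*2.+1 = - 2%:R * G r.*2 by apply: (eq_by 0 _ _ _ h1); ring.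
  by rewrite A1 D1; split=> [||j [<-]|]; rewrite ?l0 ?ltnn //; field.
have k_lt : (k < r.*2)%N by lia.
have [kE|k1_neq] := eqVneq k.+1 r.*2.
  have ok : odd k by rewrite -[odd k]negbK -oddS kE odd_double.
  rewrite /scale.
  have -> : adiag r k.+1 = 2%N by rewrite /adiag kE eqxx !ifN //; lia.
  have -> : ddiag r k.+1 = 0%N by rewrite /ddiag kE eqxx !ifN //; lia.
  have l0 : link r k = 1%N by rewrite link_mid ?ok // k_gt0.
  have l1 : link r k.+1 = 3%N by rewrite /link kE eqxx orbT.
  have [rho rho0|h0 h1 h2] := @quadratic_coef_eq0 C (A k.+1 + 2%:R * G k)
      (2%:R * A k.+1 + D k.+1 + G k + E k.+2) (2%:R * D k.+1).
    have := eqm rho rho0; rewrite /= (@profile_odd _ k) //.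
    rewrite (@profile_even _ k.+1) /= ?ok //.
    by rewrite kE profile_last !ltnS leqnn => h; rewrite -[RHS]h; ring.
  have D1 : D k.+1 = 0 by apply: (eq_by 1 _ _ _ h2); ring.
  have A1 : A k.+1 = - 2%:R * G k by apply: (eq_by 0 _ _ _ h0); ring.
  have E1 : E k.+2 = 3%:R * G k.
    by move: h1; rewrite A1 D1 => h1; apply: (eq_by 0 _ _ _ h1); ring.
  by rewrite A1 D1; split=> // [|j [<-]|_]; rewrite ?E1 ?l0 ?l1; field.
have k1_mid : (1 < k.+1 < r.*2)%N by lia.
have k2s : (k.+2 < r.*2.+2)%N by lia.
rewrite /scale adiag_mid ?ddiag_mid // [link r k.+1]link_mid; last lia.
have lk : link r k = if odd k then 1%N else 2%N by rewrite link_mid // k_gt0.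
case ok: (odd k) in lk *; rewrite /= ?ok /=.
  have [rho rho0|h0 h1 h2] := @quadratic_coef_eq0 C (A k.+1 + 2%:R * G k)
      (2%:R * A k.+1 + D k.+1 + G k + 2%:R * E k.+2) (2%:R * D k.+1 + E k.+2).
    have := eqm rho rho0; rewrite k2s (@profile_odd _ k) //.
    rewrite (@profile_even _ k.+1) /= ?ok //.
    rewrite (@profile_odd _ k.+2) /= ?ok //; last lia.
    by move=> h; rewrite -[RHS]h; ring.
  have A1 : A k.+1 = - 2%:R * G k by apply: (eq_by 0 _ _ _ h0); ring.
  have E1 : E k.+2 = - 2%:R * D k.+1 by apply: (eq_by 0 _ _ _ h2); ring.
  have D1 : D k.+1 = - G k.
    by move: h1; rewrite A1 E1 => h1; apply/esym/(eq_by 2 _ _ _ h1); ring.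
  by rewrite E1 A1 D1; split=> // [||j [<-]|_]; rewrite ?lk; field.
have [rho rho0|h0 h1 h2] := @quadratic_coef_eq0 C (2%:R * A k.+1 + G k)
    (A k.+1 + 2%:R * D k.+1 + 2%:R * G k + E k.+2) (D k.+1 + 2%:R * E k.+2).
  have := eqm rho rho0; rewrite k2s (@profile_odd _ k.+1) /= ?ok //; last lia.
  rewrite !profile_even /= ?ok // => h; rewrite -[RHS]h; ring.
have G1 : G k = - 2%:R * A k.+1 by apply: (eq_by 0 _ _ _ h0); ring.
have D1 : D k.+1 = - 2%:R * E k.+2 by apply: (eq_by 0 _ _ _ h2); ring.
have E1 : E k.+2 = - A k.+1.
  by move: h1; rewrite G1 D1 => h1; apply/esym/(eq_by 2 _ _ _ h1); ring.
by rewrite D1 E1; split=> // [||j [<-]|_]; rewrite ?G1 ?lk; field.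
Qed.

End Row.
End Kernel.

(** * Hermitian solutions are scalar multiples *)

Section Rigidity.

Variables (C : numClosedFieldType) (r : nat).
Hypothesis r_gt0 : (0 < r)%N.

(** The functions 1, |z|^2, z and its conjugate are already linearly independent on the points 0, 1,
    -1, i. *)
Lemma hermitian_pencil_coefs (a d e g a' d' e' g' : C) :
  (forall z, a + z * z^* * d + z^* * e + z * g =
    (a' + z * z^* * d' + z^* * e' + z * g')^*) ->
  [/\ a = a'^*, d = d'^* & e = g'^*].
Proof.
move=> H; have := H 0; have := H 1; have := H (-1); have := H 'i.
rewrite !rmorphD !rmorphM !rmorphN /= !conjCK conjC0 conjC1 conjCi.
rewrite (mulrN 'i 'i) (mulNr 'i 'i) -expr2 sqrCi opprK.
move: a'^* d'^* e'^* g'^* => {H a' d' e' g'} a' d' e' g' Hi Hm H1 H0.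
have aE : a = a' by move: H0; rewrite !mul0r !addr0.
have dE : d = d'.
  apply: (mulfI (x := 2%:R)); first by rewrite pnatr_eq0.
  transitivity ((a + 1 * 1 * d + 1 * e + 1 * g)
    + (a + -1 * -1 * d + -1 * e + -1 * g) - 2%:R * a); first by ring.
  by rewrite H1 Hm aE; ring.
split=> //; rewrite aE dE in H1 Hi.
apply: (mulfI (x := 2%:R * 'i)); first by rewrite mulf_neq0 ?pnatr_eq0 ?neq0Ci.
transitivity ('i * (a' + 1 * 1 * d' + 1 * e + 1 * g)
    - (a' + 1 * d' + - 'i * e + 'i * g) - ('i - 1) * (a' + d')); first by ring.
by rewrite H1 Hi; ring.
Qed.

Variables A D E G : nat -> nat -> C.
Let F z i j := A i j + z * z^* * D i j + z^* * E i j + z * G i j.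
Hypothesis herm : forall z i j, (i < r.*2.+2)%N -> (j < r.*2.+2)%N ->
  F z i j = (F z j i)^*.
Hypothesis ker : forall z i, (i < r.*2.+2)%N ->
  \sum_(j < r.*2.+2) F z i j * kernel_vec r z j = 0.

Lemma link_gt0 i : (0 < link r i)%N.
Proof. by rewrite /link; do 2?case: ifP. Qed.

(** By [row_scale] the pencil is N M with N given by [n]. Hermiticity ties (i, j) to (j, i) through
    A, and to (j+1, i+1) through E and G. The zeros of row 0 thus spread to all off-diagonal
    entries, and the diagonal is constant and real. *)
Lemma kernel_rigidity : exists c : C, forall i j a d b b',
  (i < r.*2.+2)%N -> (j < r.*2.+2)%N ->
  A i j * a + D i j * d + E i j * b + G i j * b' = c * entry r a d b b' i j.
Proof.
have hAE i j (ir : (i < r.*2.+2)%N) (jr : (j < r.*2.+2)%N) :=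
  hermitian_pencil_coefs (fun z => herm z ir jr).
pose n i j := (A i j + D i j) / (adiag r j + ddiag r j)%:R.
have nP i j (ir : (i < r.*2.+2)%N) := row_scale r_gt0 (fun z => ker z ir) (m := j).
have E0 i : (i < r.*2.+2)%N -> E i 0 = 0.
  by move=> ir; have [] := row_coefs (fun z => ker z ir) ltr01 erefl.
have G0 i : (i < r.*2.+2)%N -> G i r.*2.+1 = 0.
  by move=> ir; have [] := row_coefs (fun z => ker z ir) ltr01 erefl.
have step i j : (i.+1 < r.*2.+2)%N -> (j.+1 < r.*2.+2)%N ->
    n j.+1 i.+1 *+ link r i = (n i j)^* *+ link r j.
  move=> ir jr; have [_ _ Ej] := hAE _ _ (ltnW ir) jr.
  have [_ _ _ /(_ jr) E_ij] := nP i j (ltnW ir) (ltnW jr).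
  have [_ _ /(_ _ erefl) G_ij _] := nP _ _ jr ir.
  move: Ej; rewrite E_ij G_ij rmorphN rmorphMn /= => /oppr_inj h.
  by apply: (can_inj conjCK); rewrite !rmorphMn /= conjCK; apply: esym h.
have AE k l (kr : (k < r.*2.+2)%N) (lr : (l < r.*2.+2)%N) :
    n k l *+ adiag r l = (n l k)^* *+ adiag r k.
  have [Akl _ _] := hAE _ _ kr lr.
  have [nkl _ _ _] := nP k l kr lr; have [nlk _ _ _] := nP l k lr kr.
  by rewrite -[LHS]nkl Akl [in LHS]nlk rmorphMn.
have neq0 i j : (i < r.*2.+2)%N -> (j < r.*2.+2)%N -> i != j -> n i j = 0.
  (* Column 0 of E vanishes, and its conjugate is row 0 of G, which is made of link multiples of row
     0 of N. *)
  have row0 k : (k.+1 < r.*2.+2)%N -> n 0 k.+1 = 0.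
    move=> kr; have [_ _ /(_ _ erefl) Gk _] := nP 0 k.+1 isT kr.
    have [_ _ Ek] := hAE k 0 (ltnW kr) isT.
    move: Ek; rewrite E0 ?(ltnW kr) // Gk rmorphN rmorphMn => /esym/eqP.
    by rewrite oppr_eq0 mulrn_eq0 (gtn_eqF (link_gt0 _)) /= conjC_eq0 => /eqP.
  (* Both entries are carried in the induction because [step] transposes the indices. *)
  suff both m : forall l, (m < r.*2.+2)%N -> (l < r.*2.+2)%N -> m != l ->
      n m l = 0 /\ n l m = 0 by move=> ir jr ij; have [] := both i j ir jr ij.
  have col0 k : (k.+1 < r.*2.+2)%N -> n k.+1 0 = 0.
    move=> kr; have /eqP := AE k.+1 0 kr isT.
    by rewrite row0 // conjC0 mul0rn mulrn_eq0 => /eqP.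
  elim: m => [|m IHm] [|l] // mr lr ml; first by rewrite row0 ?col0.
    by rewrite row0 ?col0.
  have [nml nlm] := IHm l (ltnW mr) (ltnW lr) ml.
  have /eqP := step l m lr mr; have /eqP := step m l mr lr.
  rewrite nml nlm conjC0 !mul0rn !mulrn_eq0 !(gtn_eqF (link_gt0 _)) /=.
  by move=> /eqP -> /eqP ->.
exists (n 0 0) => i j a d b b' ir jr.
have diag k : (k < r.*2.+2)%N -> n k k = n 0 0.
  elim: k => // k IHk kr; have /eqP := step k k kr kr.
  rewrite IHk ?(ltnW kr) // -!(mulr_natr (n _ _)) -!(mulr_natr (_^*)) => /eqP h.
  suff <- : (n 0 0)^* = n 0 0.
    by apply: (mulIf _ h); rewrite pnatr_eq0 -lt0n link_gt0.
  (* 6 is [adiag] at 0. *)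
  apply: (mulIf (x := 6%:R)); first by rewrite pnatr_eq0.
  by have := AE 0 0 isT isT; rewrite -!(mulr_natr (n _ _)) -!(mulr_natr (_^*)).
have nE k l : (k < r.*2.+2)%N -> (l < r.*2.+2)%N -> n k l = if k == l then n 0 0 else 0.
  by move=> kr lr; case: eqP => [<-|/eqP kl]; [exact: diag | exact: neq0].
have [Aij Dij _ _] := nP i j ir jr.
rewrite -/(n i j) nE // in Aij Dij; rewrite {}Aij {}Dij.
have -> : E i j = if j == i.+1 then - (n 0 0 *+ link r i) else 0.
  case: j jr => [|j] jr; first by rewrite E0.
  have [_ _ _ /(_ jr) ->] := nP i j ir (ltnW jr).
  rewrite -/(n i j) nE ?(ltnW jr) // eqSS eq_sym.
  by case: eqP => [->//|_]; rewrite mul0rn oppr0.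
have -> : G i j = if i == j.+1 then - (n 0 0 *+ link r j) else 0.
  have [->|jr1] := eqVneq j r.*2.+1; first by rewrite G0 // ltn_eqF.
  have jr2 : (j.+1 < r.*2.+2)%N by lia.
  have [_ _ /(_ _ erefl) -> _] := nP i j.+1 ir jr2.
  by rewrite -/(n i j.+1) nE //; case: eqP => // _; rewrite mul0rn oppr0.
rewrite /entry; case: (eqVneq i j) => [->|ij].
  by rewrite !ltn_eqF //; ring.
case: (eqVneq j i.+1) => [->|ji]; first by rewrite ltn_eqF //; ring.
by case: eqVneq => _; ring.
Qed.

End Rigidity.

(** * Positive semidefinite matrices *)

Section PositiveSemidefinite.

Local Open Scope sesquilinear_scope.

Variables (R : realType) (n : nat).
Local Notation C := R[i].

Lemma hermsymmxP (P : 'M[C]_n) :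
  reflect (forall i j, P i j = (P j i)^*) (P \is hermsymmx).
Proof.
apply: (iffP (is_hermitianmxP _ _ _)); rewrite expr0 scale1r.
  by move=> PE i j; rewrite {1}PE !mxE.
by move=> PE; apply/matrixP => i j; rewrite !mxE PE.
Qed.

Lemma quad_formE (P : 'M[C]_n) (x : 'cV_n) :
  (x ^t* *m P *m x) ord0 ord0 =
  \sum_i \sum_j (x i ord0)^* * P i j * x j ord0.
Proof.
rewrite mxE exchange_big /=; apply: eq_bigr => j _.
by rewrite mxE mulr_suml; apply: eq_bigr => i _; rewrite !mxE.
Qed.

Lemma psdmx_outer (v : 'cV[C]_n) : psdmx (v *m v ^t*).
Proof.
split=> [|x].
  by apply/hermsymmxP => i j; rewrite !mxE !big_ord1 !mxE rmorphM /= conjCK mulrC.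
rewrite mulmxA -mulmxA mxE big_ord1.
have -> : (v ^t* *m x) ord0 ord0 = ((x ^t* *m v) ord0 ord0)^*.
  rewrite !mxE rmorph_sum; apply: eq_bigr => i _.
  by rewrite !mxE rmorphM /= conjCK mulrC.
exact: mul_conjC_ge0.
Qed.

Lemma psdmx_diag_ge0 (P : 'M[C]_n) i : psdmx P -> 0 <= P i i.
Proof.
case=> _ /(_ (delta_mx i ord0)); rewrite trmx_delta map_delta_mx.
by rewrite -rowE -colE !mxE.
Qed.

(** With y = P x, the form at x - e y equals -2 e |y|^2 + e^2 q, where q is the form at y; for small
    e > 0 this is negative unless y = 0. *)
Lemma psdmx_ker (P : 'M[C]_n) (x : 'cV_n) :
  psdmx P -> (x ^t* *m P *m x) ord0 ord0 = 0 -> P *m x = 0.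
Proof.
case=> /hermsymmxP Pherm Ppos x0.
have PC : P ^t* = P by apply/matrixP => i j; rewrite !mxE -Pherm.
have [y yE] : exists y, y = P *m x by exists (P *m x).
have [N ND] : exists N, (y ^t* *m y) ord0 ord0 = N by eexists.
have [q qD] : exists q, (y ^t* *m P *m y) ord0 ord0 = q by eexists.
have yC : y ^t* = x ^t* *m P by rewrite yE trmx_mul map_mxM PC.
have NE : N = \sum_i `|y i ord0| ^+ 2.
  by rewrite -ND mxE; apply: eq_bigr => i _; rewrite !mxE mulrC -normCK.
have N_ge0 : 0 <= N by rewrite NE sumr_ge0 // => i _; rewrite exprn_ge0.
have q_ge0 : 0 <= q by rewrite -qD.
have [N0|N_neq0] := eqVneq N 0.
  rewrite -yE; apply/matrixP => i j; rewrite ord1 [RHS]mxE.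
  have := N0; rewrite NE => /eqP; rewrite psumr_eq0 => [|k _]; last exact: exprn_ge0.
  by move/allP/(_ i (mem_index_enum _)); rewrite sqrf_eq0 normr_eq0 => /eqP.
have N_gt0 : 0 < N by rewrite lt0r N_neq0.
(* With this e, N - e q = e, so the form equals -e (N + e); the added 1 covers q = 0. *)
pose e := N / (q + 1).
have q1 : 0 < q + 1 by rewrite ltr_wpDl.
have e_gt0 : 0 < e by rewrite divr_gt0.
have eR : e^* = e by apply/CrealP/ger0_real/ltW.
have := Ppos (x - e *: y).
have -> : (x - e *: y) ^t* = x ^t* - e *: y ^t*.
  by apply/matrixP => i j; rewrite !mxE rmorphB rmorphM /= eR.
have yPx : y ^t* *m P *m x = y ^t* *m y by rewrite -mulmxA -yE.
rewrite !mulmxBl !mulmxBr -yC -!scalemxAl -!scalemxAr yPx.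
have mx11B (A B : 'M[C]_1) : (A - B) ord0 ord0 = A ord0 ord0 - B ord0 ord0.
  by rewrite !mxE.
have mx11Z (A : 'M[C]_1) a : (a *: A) ord0 ord0 = a * A ord0 ord0 by rewrite mxE.
rewrite !(mx11B, mx11Z) yC x0 -yC ND qD.
have -> : 0 - e * N - (e * N - e * (e * q)) = - (e * (N + e)).
  by rewrite /e; field; rewrite lt0r_neq0.
by rewrite oppr_ge0 lt_geF // mulr_gt0 // addr_gt0.
Qed.

End PositiveSemidefinite.

(** * The normalized map *)

Lemma mx2_delta (K : comNzRingType) (X : 'M[K]_2) :
  X = X ord0 ord0 *: delta_mx ord0 ord0 + X ord0 ord_max *: delta_mx ord0 ord_max
    + (X ord_max ord0 *: delta_mx ord_max ord0
       + X ord_max ord_max *: delta_mx ord_max ord_max).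
Proof.
rewrite {1}[X]matrix_sum_delta !big_ord_recl !big_ord0 !addr0.
by rewrite (_ : lift ord0 ord0 = ord_max); last exact: val_inj.
Qed.

Lemma diag_gt0 r i : (0 < adiag r i + ddiag r i)%N.
Proof. by rewrite /adiag /ddiag; do 5?case: ifP. Qed.

(** At the identity the tridiagonal matrix is diagonal with entries [adiag + ddiag]; congruence by
    these factors turns it into the identity. *)
Definition normalizer (C : numClosedFieldType) (r i : nat) : C :=
  sqrtC (adiag r i + ddiag r i)%:R^-1.

Lemma normalizer_gt0 (C : numClosedFieldType) r i : 0 < normalizer C r i.
Proof. by rewrite sqrtC_gt0 invr_gt0 ltr0n diag_gt0. Qed.

Lemma normalizer_conj (C : numClosedFieldType) r i :
  (normalizer C r i)^* = normalizer C r i.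
Proof. exact/CrealP/ger0_real/ltW/normalizer_gt0. Qed.

Definition extreme_map (R : realType) (r : nat) (X : 'M[R[i]]_2) :
    'M[R[i]]_(r.*2.+2) :=
  \matrix_(i, j) (normalizer R[i] r i * normalizer R[i] r j *
    entry r (X ord0 ord0) (X ord_max ord_max) (X ord0 ord_max) (X ord_max ord0) i j).

Lemma extreme_map_is_linear (R : realType) (r : nat) :
  linear (@extreme_map R r).
Proof.
move=> c X Y; apply/matrixP => i j; rewrite !mxE /entry.
by do 3?case: ifP => _; ring.
Qed.

HB.instance Definition _ (R : realType) (r : nat) :=
  GRing.isLinear.Build R[i] 'M[R[i]]_2 'M[R[i]]_(r.*2.+2) *:%R
    (@extreme_map R r) (@extreme_map_is_linear R r).

(** * Unitality, positivity and extremality *)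

Section ExtremeMap.

Local Open Scope sesquilinear_scope.

Variables (R : realType) (r : nat).
Hypothesis r_gt0 : (0 < r)%N.
Local Notation C := R[i].
Local Notation n := (r.*2.+2).
Local Notation tau := (normalizer C r).

Lemma extreme_map_unital : unital_map (@extreme_map R r).
Proof.
apply/matrixP => i j; rewrite !mxE /= /entry.
have [->|ij] := eqVneq i j.
  rewrite eqxx -mulrnDr -expr2 sqrtCK mulVf // pnatr_eq0 -lt0n; exact: diag_gt0.
rewrite val_eqE (negbTE ij) !mul0rn oppr0.
by do 2?case: ifP => _; rewrite mulr0.
Qed.

Lemma extreme_map_positive : positive_map (@extreme_map R r).
Proof.
move=> X [/hermsymmxP Xherm Xpos].
have aR := Xherm ord0 ord0; have dR := Xherm ord_max ord_max.
have bE := Xherm ord_max ord0.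
split.
  apply/hermsymmxP => i j; rewrite !mxE !rmorphM /= !normalizer_conj.
  rewrite [tau i * _]mulrC; congr (_ * _).
  rewrite /entry [j == i :> nat]eq_sym; case: (eqVneq (i : nat) j) => [->|ij].
    by rewrite rmorphD !rmorphMn /= -aR -dR.
  case: (eqVneq (j : nat) i.+1) => [->|ji].
    by rewrite ?eqxx ltn_eqF ?leqnSn // rmorphN rmorphMn /= bE conjCK.
  by case: eqVneq => _; rewrite ?rmorph0 // rmorphN rmorphMn /= -bE.
move=> x; rewrite quad_formE.
pose w k := tau k * x (inord k) ord0.
have psd2 (u v : C) : 0 <= u^* * X ord0 ord0 * u + u^* * X ord0 ord_max * v
    + v^* * (X ord0 ord_max)^* * u + v^* * X ord_max ord_max * v.
  have := Xpos (\col_i if i == ord0 then u else v).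
  rewrite quad_formE !big_ord_recl !big_ord0 !mxE /= -bE.
  rewrite (_ : lift ord0 ord0 = ord_max); last exact: val_inj.
  by rewrite !addr0 addrA.
rewrite (eq_bigr (fun i : 'I_n => \sum_(j < n) (w i)^* *
    entry r (X ord0 ord0) (X ord_max ord_max) (X ord0 ord_max)
      (X ord0 ord_max)^* i j * w j)); last first.
  move=> i _; apply: eq_bigr => j _.
  by rewrite !mxE /w !inord_val rmorphM /= normalizer_conj -bE; ring.
have := a_ge0 psd2; have := d_ge0 psd2.
(* [entry_quad_form_ge0] asks for a positive trace; a positive semidefinite X of trace zero is
   zero. *)
case: (eqVneq (X ord0 ord0 + X ord_max ord_max) 0) => [ad0|ad_neq0] d0 a0.
  have [a_eq0 d_eq0] : X ord0 ord0 = 0 /\ X ord_max ord_max = 0.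
    by move/eqP: ad0; rewrite paddr_eq0 // => /andP[/eqP -> /eqP ->].
  have b_eq0 : X ord0 ord_max = 0.
    apply/eqP; rewrite -normr_eq0 -sqrf_eq0 eq_le exprn_ge0 // andbT.
    rewrite normCK -oppr_ge0 -(pmulr_rge0 _ (ltr0Sn C 1)).
    have := psd2 (X ord0 ord_max) (-1); rewrite a_eq0 d_eq0 rmorphN /= conjC1.
    by congr (0 <= _); ring.
  rewrite big1 // => i _; rewrite big1 // => j _.
  rewrite /entry a_eq0 d_eq0 b_eq0 conjC0 !mul0rn oppr0 addr0.
  by do 3?case: ifP => _; rewrite mulr0 mul0r.
apply: entry_quad_form_ge0 => //.
by rewrite lt0r ad_neq0 addr_ge0.
Qed.

Let v (z : C) : 'cV[C]_2 := \col_i (if i == ord0 then 1 else z).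

(** Dividing by [tau] cancels the right factor of the congruence. *)
Let x (z : C) : 'cV[C]_n := \col_i (kernel_vec r z i / tau i).

Let outer_v z : let P := v z *m (v z) ^t* in
  [/\ P ord0 ord0 = 1, P ord_max ord_max = z * z^*,
      P ord0 ord_max = z^* & P ord_max ord0 = z].
Proof. by split; rewrite !mxE big_ord1 !mxE /= ?conjC1 ?mul1r ?mulr1. Qed.

Let tau_neq0 i : tau i != 0.
Proof. by rewrite lt0r_neq0 ?normalizer_gt0. Qed.

Lemma extreme_map_kernel z : extreme_map r (v z *m (v z) ^t*) *m x z = 0.
Proof.
apply/matrixP => i j; rewrite [LHS]mxE [RHS]mxE.
have [P00 P11 P01 P10] := outer_v z.
transitivity (tau i * \sum_(k < n) entry r 1 (z * z^*) z^* z i k *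
    kernel_vec r z k); last by rewrite entry_kernel_vec ?mulr0.
rewrite mulr_sumr; apply: eq_bigr => k _; rewrite mxE [x z _ _]mxE P00 P11 P01 P10.
by field; rewrite tau_neq0.
Qed.

(** At each v v^* the two nonnegative forms add up to zero on the kernel vector, so [psdmx_ker]
    makes [Phi1] annihilate it and [kernel_rigidity] applies. *)
Lemma nonneg_multiple_summand (Phi1 Phi2 : {linear 'M[C]_2 -> 'M[C]_n}) :
  positive_map Phi1 -> positive_map Phi2 ->
  (forall X, extreme_map r X = Phi1 X + Phi2 X) ->
  nonneg_multiple Phi1 (@extreme_map R r).
Proof.
move=> pos1 pos2 sumE.
have ker1 z : Phi1 (v z *m (v z) ^t*) *m x z = 0.
  have psdP := psdmx_outer (v z); set P := _ *m _ in psdP *.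
  apply: (psdmx_ker (pos1 _ psdP)); apply/eqP.
  have [_ /(_ (x z)) ge1] := pos1 _ psdP; have [_ /(_ (x z)) ge2] := pos2 _ psdP.
  suff : (x z ^t* *m Phi1 P *m x z) ord0 ord0 +
      (x z ^t* *m Phi2 P *m x z) ord0 ord0 == 0.
    by rewrite paddr_eq0 // => /andP[].
  have -> : (x z ^t* *m Phi1 P *m x z) ord0 ord0 +
      (x z ^t* *m Phi2 P *m x z) ord0 ord0 =
      (x z ^t* *m Phi1 P *m x z + x z ^t* *m Phi2 P *m x z) ord0 ord0.
    by rewrite [RHS]mxE.
  by rewrite -mulmxDl -mulmxDr -sumE -mulmxA extreme_map_kernel mulmx0 mxE.
(* [L] undoes the congruence; its values on the matrix units are the coefficients of the pencil. *)
pose L X i j := Phi1 X (inord i) (inord j) / (tau i * tau j).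
pose A := L (delta_mx ord0 ord0); pose D := L (delta_mx ord_max ord_max).
pose E := L (delta_mx ord0 ord_max); pose G := L (delta_mx ord_max ord0).
have LE X i j : L X i j = A i j * X ord0 ord0 + D i j * X ord_max ord_max
    + E i j * X ord0 ord_max + G i j * X ord_max ord0.
  rewrite /L {1}[X]mx2_delta !linearD !linearZ /= !mxE /A /D /E /G /L.
  by field; rewrite !tau_neq0.
have Lv z i j : A i j + z * z^* * D i j + z^* * E i j + z * G i j =
    L (v z *m (v z) ^t*) i j.
  by have [P00 P11 P01 P10] := outer_v z; rewrite LE P00 P11 P01 P10; ring.
have herm z i j : (i < n)%N -> (j < n)%N ->
    A i j + z * z^* * D i j + z^* * E i j + z * G i j =
    (A j i + z * z^* * D j i + z^* * E j i + z * G j i)^*.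
  move=> _ _; rewrite !Lv /L.
  have [/hermsymmxP -> _] := pos1 _ (psdmx_outer (v z)).
  by rewrite fmorph_div rmorphM /= !normalizer_conj [tau j * _]mulrC.
have kerF z i : (i < n)%N -> \sum_(j < n)
    (A i j + z * z^* * D i j + z^* * E i j + z * G i j) * kernel_vec r z j = 0.
  move=> ir; have /matrixP/(_ (inord i) ord0) := ker1 z.
  rewrite [LHS]mxE [RHS]mxE => h.
  apply: (mulfI (tau_neq0 i)); rewrite mulr0; apply: etrans h; rewrite mulr_sumr.
  apply: eq_bigr => k _; rewrite Lv /L inord_val [x z _ _]mxE.
  by field; rewrite !tau_neq0.
have [c cE] := kernel_rigidity r_gt0 herm kerF.
(* The sign is read off the corner entry at v = (1, 0), where [adiag] is 6. *)
have c_ge0 : 0 <= c.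
  have /(psdmx_diag_ge0 ord0) := pos1 _ (psdmx_outer (v 0)).
  have -> : Phi1 (v 0 *m (v 0) ^t*) ord0 ord0 = 6%:R * (tau 0 * tau 0) * c.
    have := cE 0 0 1 0 0 0 isT isT; have := Lv 0 0 0.
    rewrite /entry /= !mul0r conjC0 !mul0r !addr0 mulr1 => -> .
    rewrite !mulr0 !addr0 mul0rn addr0 /L !(@inord_val _ ord0) => h.
    by rewrite -[LHS](divfK (mulf_neq0 (tau_neq0 0) (tau_neq0 0))) h; ring.
  by rewrite pmulr_rge0 // !mulr_gt0 ?normalizer_gt0 ?ltr0n.
exists (complex.Re c); have cR := RRe_real (ger0_real c_ge0); split.
  by rewrite -ler0c cR.
move=> X; rewrite cR; apply/matrixP => i j; rewrite !mxE -mulrCA -cE // -LE /L.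
by rewrite !inord_val; field; rewrite !tau_neq0.
Qed.

End ExtremeMap.

Theorem corollary4p2 (R : realType) (r : nat) (hr : (1 <= r)%N) :
  exists Phi : {linear 'M[R[i]]_2 -> 'M[R[i]]_(2 * r + 2)},
    [/\ positive_map Phi, unital_map Phi & generates_extreme_ray Phi].
Proof.
(* The two dimensions are not convertible; rewriting before the witness is given avoids a cast. *)
have -> : (2 * r + 2 = r.*2.+2)%N by lia.
have pos := @extreme_map_positive R r hr; have unit := @extreme_map_unital R r.
exists (@extreme_map R r); split=> //; split=> //.
  by exists 1%:M; rewrite unit; apply: oner_neq0.
move=> Phi1 Phi2 pos1 pos2 sumE.
split; first exact: (nonneg_multiple_summand hr pos1 pos2 sumE).
by apply: (nonneg_multiple_summand hr pos2 pos1) => X; rewrite sumE addrC.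
Qed.
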